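(* Let $(M,g)$ be a 4-dimensional Walker manifold equipped, in coordinates $(x,y,z,t)$, with the metric $$g=2\,\mathrm{d}x\,\mathrm{d}z+2\,\mathrm{d}y\,\mathrm{d}t+b(t)\,\mathrm{d}t^2,$$ where $b$ is a smooth function of $t$ only. Then $(M,g)$ is a gradient Yamabe soliton if and only if its potential function is defined by $$f(x,y,z,t)=x(c_0z+c_2)+y(c_0t+c_1)+c_3z+E(t),$$ where $c_i\in\mathbb{R}$ ($i=0,1,2,3$) and the metric function $b(t)$ and the function $E(t)$ are related by $$2E'(t)-b(t)(c_0t+c_1)=c_0\int_{t_0}^t b(\bar t)\,\mathrm{d}\bar t.$$ Moreover, $\Delta(f)=4c_0$.
   Context: A pseudo-Riemannian manifold $(M,g)$ is a gradient Yamabe soliton if there exist a smooth function $f$ on $M$ (the potential function) and a constant $\lambda\in\mathbb{R}$ with $\mathrm{Hess}(f)=(\tau-\lambda)g$, where $\tau$ is the scalar curvature of $(M,g)$. A 4-dimensional Walker manifold is a 4-manifold with a metric $g$ of neutral signature $(-,-,+,+)$ and a 2-dimensional parallel null plane field $D$; here $D=\langle\partial_x,\partial_y\rangle$. $\Delta$ is the trace of the Hessian with respect to $g$.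
   Formalization: The relation between b and E is stated with an additive constant of integration k on the right-hand side; without it the ''only if'' part fails, e.g. f = t has zero Hessian and zero scalar curvature but would require 2 = 0. *)

(* Defs.v *)
From HB Require Import structures.
From mathcomp Require Export all_boot all_order all_algebra.
From mathcomp Require Export all_classical all_reals all_analysis.
Import Order.TTheory GRing.Theory Num.Theory.
Export numFieldNormedType.Exports.

Set Implicit Arguments.
Unset Strict Implicit.
Unset Printing Implicit Defensive.

Local Open Scope ring_scope.
Local Open Scope classical_set_scope.

Section CoordinateGeometry.
Context {R : realType} {n : nat}.
Implicit Types (f : 'rV[R]_n -> R) (g : 'rV[R]_n -> 'M[R]_n) (p : 'rV[R]_n).
Implicit Types (U : set 'rV[R]_n).

Definition partial (i : 'I_n) f : 'rV[R]_n -> R :=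
  fun p => 'D_(delta_mx 0 i) f p.

Definition iter_partial (s : seq 'I_n) f : 'rV[R]_n -> R :=
  foldr partial f s.

(* Since U is open in every use, the iterated partial derivatives at the
   points of U only depend on f restricted to U. *)
Definition smooth_on U f : Prop :=
  forall (s : seq 'I_n) p, U p ->
    {for p, continuous (iter_partial s f)} /\
    forall i, derivable (iter_partial s f) p (delta_mx 0 i).

(* christoffel g k i j is $\Gamma^k_{ij}$. *)
Definition christoffel g (k i j : 'I_n) : 'rV[R]_n -> R := fun p =>
  2^-1 * \sum_l invmx (g p) k l *
    (partial i (fun q => g q j l) p + partial j (fun q => g q i l) p
     - partial l (fun q => g q i j) p).

(* riemann g l k i j is the component $R^l{}_{kij}$, where
   $R(\partial_i,\partial_j)\partial_k = R^l{}_{kij}\partial_l$ and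
   $R(X,Y) = [\nabla_X,\nabla_Y] - \nabla_{[X,Y]}$. *)
Definition riemann g (l k i j : 'I_n) : 'rV[R]_n -> R := fun p =>
  partial i (christoffel g l j k) p - partial j (christoffel g l i k) p
  + \sum_m (christoffel g l i m p * christoffel g m j k p
            - christoffel g l j m p * christoffel g m i k p).

Definition ricci g p : 'M[R]_n :=
  \matrix_(j, k) \sum_i riemann g i k i j p.

Definition scalar_curvature g p : R := \tr (invmx (g p) *m ricci g p).

Definition hessian g f p : 'M[R]_n :=
  \matrix_(i, j) (partial i (partial j f) p
                  - \sum_k christoffel g k i j p * partial k f p).

Definition laplacian g f p : R := \tr (invmx (g p) *m hessian g f p).

(* f is a potential function making (U, g) a gradient Yamabe soliton. *)
Definition gradient_yamabe_potential U g f : Prop :=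
  smooth_on U f /\
  exists lambda : R, forall p, U p ->
    hessian g f p = (scalar_curvature g p - lambda) *: g p.

End CoordinateGeometry.

Section Walker.
Context {R : realType}.
Implicit Types (b E : R -> R) (p : 'rV[R]_4) (U : set 'rV[R]_4) (I : set R).

Definition ix : 'I_4 := @Ordinal 4 0 isT.
Definition iy : 'I_4 := @Ordinal 4 1 isT.
Definition iz : 'I_4 := @Ordinal 4 2 isT.
Definition it : 'I_4 := @Ordinal 4 3 isT.

(* $2\,dx\,dz + 2\,dy\,dt + b(t)\,dt^2$, where $2\,dx\,dz$ stands for
   $dx\otimes dz + dz\otimes dx$. *)
Definition walker_metric b p : 'M[R]_4 :=
  delta_mx ix iz + delta_mx iz ix + delta_mx iy it + delta_mx it iy
  + b (p 0 it) *: delta_mx it it.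

Definition smooth_on1 I b : Prop :=
  forall (k : nat) (t : R), I t -> derivable (derive1n k b) t 1.

Definition t_range U : set R := [set p 0 it | p in U].

(* $\int_a^c b$ with the usual sign convention when $c < a$. *)
Definition oriented_integral b (a c : R) : R :=
  if a <= c then \int[lebesgue_measure]_(s in `[a, c]) b s
  else - \int[lebesgue_measure]_(s in `[c, a]) b s.

(* The relation between b and E integrates the equation
   $2E'' - b'(c_0t+c_1) = 2c_0b$ once; k is the integration constant.  It cannot
   be absorbed by the base point t0: f = t has zero Hessian, hence is a
   potential function, but it satisfies the relation only with k = 2. *)
Definition potential_form U b (t0 c0 c1 c2 c3 k : R) E (f : 'rV[R]_4 -> R) :
    Prop :=
  [/\ smooth_on1 (t_range U) E,
      forall p, U p ->
        f p = p 0 ix * (c0 * p 0 iz + c2) + p 0 iy * (c0 * p 0 it + c1)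
              + c3 * p 0 iz + E (p 0 it)
    & forall t, t_range U t ->
        2 * derive1 E t - b t * (c0 * t + c1)
        = c0 * oriented_integral b t0 t + k].

End Walker.

(* Main.v *)
(* The only nonzero Christoffel symbol is Γ^y_tt = b'/2, a function of t alone,
   so the metric is flat and the soliton equation reads Hess f = c0 g with
   c0 = -λ.  It says that all partial derivatives of f_x - c0 z, f_y - c0 t,
   f_z - c0 x and f_t - c0 y - G(t), where G = (b (c0 t + c1) + c0 ∫b) / 2,
   vanish; these functions are therefore constant on the connected set U.  The
   same argument applied to f minus the resulting normal form concludes.  Since
   the primitives involved are functions on the whole interval of values of t,
   the slices t = const of U may be disconnected. *)
Require Import Defs.
From mathcomp Require Import ring lra.
Import Order.TTheory GRing.Theory Num.Theory.
Set Implicit Arguments.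
Unset Strict Implicit.
Local Open Scope ring_scope.
Local Open Scope classical_set_scope.

(** * Functions of a single coordinate *)

Section CoordinateFunctions.
Context {R : realType} {n : nat}.
Implicit Types (E : R -> R) (p : 'rV[R]_n) (i j : 'I_n).

(** Equating the whole difference quotients, rather than their limits, lets one rewrite serve both
    for the value of the partial derivative and for its existence. *)
Lemma growth_rate_coord i j E p :
  (fun h : R => h^-1 *: (((fun q : 'rV[R]_n => E (q 0 j)) \o shift p)
                           (h *: delta_mx 0 i) - E (p 0 j))) =
  if i == j then fun h => h^-1 *: (E (h + p 0 j) - E (p 0 j)) else fun=> 0.
Proof.
have [<-|ij] := eqVneq i j; apply/funext => h /=.
  by rewrite !mxE !eqxx mulr1.
by rewrite !mxE eq_sym (negbTE ij) andbF mulr0 add0r subrr scaler0.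
Qed.

(* No derivability is needed: both sides are the same, possibly junk, limit. *)
Lemma partial_coord i j E p :
  partial i (fun q => E (q 0 j)) p = (i == j)%:R * derive1 E (p 0 j).
Proof.
rewrite /partial /derive growth_rate_coord /derive1.
by case: eqVneq => _; rewrite ?mul1r ?mul0r//; exact: lim_cst.
Qed.

Lemma is_derive_coord i j E p : derivable E (p 0 j) 1 ->
  is_derive p (delta_mx 0 i) (fun q => E (q 0 j))
    ((i == j)%:R * derive1 E (p 0 j)).
Proof.
move=> dE; apply: DeriveDef; last exact: partial_coord.
rewrite /derivable growth_rate_coord; case: eqVneq => _; last exact: is_cvg_cst.
by move: dE; rewrite /derivable; under eq_fun do rewrite /= [_ *: 1]mulr1.
Qed.

End CoordinateFunctions.

(** * Functions with vanishing partial derivatives on a connected open set *)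

Section ZeroGradient.
Context {R : realType}.

(** The two difference quotients are the same function of the increment. This brings directional
    derivatives within reach of the mean value theorem on the real line. *)
Lemma is_derive_line (V : normedModType R) (h : V -> R) (a v : V) (s d : R) :
  is_derive (a + s *: v) v h d -> is_derive s 1 (fun s => h (a + s *: v)) d.
Proof.
have shiftE :
    (fun e : R => e^-1 *: (((fun s => h (a + s *: v)) \o shift s) (e *: 1)
                - h (a + s *: v))) =
              (fun e : R => e^-1 *: ((h \o shift (a + s *: v)) (e *: v)
                - h (a + s *: v))).
  apply/funext => e /=; congr (_ *: (h _ - _)).
  by rewrite [e *: 1]mulr1 scalerDl addrCA.
by case=> dh hd; apply: DeriveDef; rewrite ?/derivable ?/derive shiftE.
Qed.

Lemma zero_derive_interval (I : set R) (f : R -> R) (x y : R) :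
  is_interval I -> (forall t, I t -> is_derive t 1 f 0) -> I x -> I y ->
  f x = f y.
Proof.
move=> itvI df; wlog xy : x y / x <= y.
  by move=> H Ix Iy; have [/H|/ltW/H] := leP x y; [apply|move=> /(_ Iy Ix)].
move=> Ix Iy.
have dI t : x <= t <= y -> is_derive t 1 f 0.
  by move=> txy; apply: df; exact: itvI txy.
have [t||_ _] := @MVT_segment _ f (fun=> 0) x y xy.
- by rewrite in_itv/= => /andP[/ltW ? /ltW ?]; apply: dI; apply/andP.
- apply: derivable_within_continuous => t; rewrite in_itv/= => txy.
  by have [] := dI t txy.
by rewrite mul0r => /subr0_eq ->.
Qed.

Lemma zero_gradient_ball n (h : 'rV[R]_n -> R) p e q :
  (forall p', ball p e p' -> forall i, is_derive p' (delta_mx 0 i) h 0) ->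
  ball p e q -> h q = h p.
Proof.
move=> dh pq; have [e0 _] := pq.
(* hyb 0, ..., hyb n goes from p to q changing one coordinate at a time, and
   stays in the ball since balls of row vectors are boxes. *)
pose hyb m := \row_j (if (j < m)%N then q 0 j else p 0 j) : 'rV[R]_n.
have hyb_ball m : ball p e (hyb m).
  split=> // i j; rewrite mxE (ord1 i); case: ifP => _; last exact: ballxx.
  by case: pq => _; apply.
suff H m : (m <= n)%N -> h (hyb m) = h p.
  by rewrite -(H n)//; congr h; apply/rowP => j; rewrite mxE ltn_ord.
elim: m => [_|m IHm mn]; first by congr h; apply/rowP => j; rewrite mxE.
rewrite -IHm; last exact: ltnW.
pose v : 'rV[R]_n := delta_mx 0 (Ordinal mn).
pose d := q 0 (Ordinal mn) - p 0 (Ordinal mn).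
have hybS : hyb m.+1 = hyb m + d *: v.
  apply/rowP => j; rewrite !mxE eqxx ltnS leq_eqVlt /=.
  have [jm|jm] := eqVneq j (Ordinal mn).
    by rewrite {}jm /= ?eqxx ltnn mulr1 /d addrC subrK.
  have -> : (j == m :> nat) = false.
    by apply: contra_neqF jm => /eqP ?; exact: val_inj.
  by rewrite mulr0 addr0.
rewrite hybS -[X in _ = h X]addr0 -(scale0r v).
(* Parameters for which the coordinate line stays in the box: an interval containing 0 and [d]. Only
   partial derivatives are given, so the mean value theorem is used along coordinate lines. *)
pose I := [set s | ball p e (hyb m + s *: v)].
apply: (@zero_derive_interval I (fun s => h (hyb m + s *: v))).
- move=> x y [_ Ix] [_ Iy] z /andP[xz zy]; split=> // i j.
  move: (Ix i j) (Iy i j); rewrite -!ball_normE/= !mxE.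
  by case: (_ && _); rewrite ?mulr1 ?mulr0// !ltr_norml; lra.
- by move=> s Is; apply: is_derive_line; exact: dh.
- by rewrite /I/= -hybS; exact: hyb_ball.
- by rewrite /I/= scale0r addr0; exact: hyb_ball.
Qed.

(** By the case of a ball, [h] is locally constant, so the level set of [h] through [p] is nonempty,
    open and closed in [U]. *)
Lemma zero_gradient_connected n (U : set 'rV[R]_n) (h : 'rV[R]_n -> R) :
  open U -> connected U ->
  (forall p, U p -> forall i, is_derive p (delta_mx 0 i) h 0) ->
  forall p q, U p -> U q -> h q = h p.
Proof.
move=> oU cU dh p q Up Uq.
have locU r : U r -> \forall r' \near r, U r' /\ h r' = h r.
  move=> Ur; have /nbhs_ballP[e/= e0 reU] := open_nbhs_nbhs (conj oU Ur).
  apply/nbhs_ballP; exists e => //= r' rr'; split; first exact: reU.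
  by apply: zero_gradient_ball rr' => s /reU; exact: dh.
(* An arbitrary [P] covers both the level set and its complement in [U]. *)
have open_fib (P : set R) : open [set r | U r /\ P (h r)].
  rewrite openE => r [Ur Pr]; apply: filterS (locU r Ur) => r' [Ur' hr'].
  by split=> //; rewrite hr'.
suff /seteqP[_ /(_ q Uq)[_ ->]] : [set r | U r /\ h r = h p] = U by [].
apply: cU; first by exists p.
- exists [set r | U r /\ h r = h p]; first exact: open_fib (fun x => x = h p).
  by apply/seteqP; split=> r /= => [[]|[_]].
- exists (~` [set r | U r /\ h r <> h p]).
    exact/open_closedC/(open_fib (fun x => x <> h p)).
  apply/seteqP; split=> r /= => [[Ur ->]|[Ur]]; first by split=> // -[].
  by move=> /not_andP[|/contrapT].
Qed.

End ZeroGradient.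

(** * Smoothness up to a finite order and its closure properties *)

Section SmoothUpto.
Context {R : realType} {V : normedModType R} {J : Type} (v : J -> V).
Implicit Types (U : set V) (f g : V -> R).

(* Used for partial derivatives in n variables, and with J = unit and v = 1 in one
   variable. *)
Fixpoint smooth_upto (k : nat) U f : Prop :=
  (forall p, U p -> {for p, continuous f} /\ forall j, derivable f p (v j)) /\
  if k is k'.+1 then forall j, smooth_upto k' U ('D_(v j) f) else True.

Lemma smooth_upto0 k U f : smooth_upto k U f -> smooth_upto 0 U f.
Proof. by case: k => [//|k []]. Qed.

Lemma smooth_uptoS k U f : smooth_upto k.+1 U f -> smooth_upto k U f.
Proof.
elim: k f => [|k IHk] f [f0 fS]; split => // j; exact: IHk.
Qed.

(** Since [U] is open, [f] and [g] agree near each of its points, so their derivatives agree on [U]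
    as well and the induction goes on. *)
Lemma smooth_upto_ext k U f g : open U -> (forall p, U p -> f p = g p) ->
  smooth_upto k U f -> smooth_upto k U g.
Proof.
move=> oU; elim: k f g => [|k IHk] f g fg fk.
all: have nearfg p : U p -> \near p, f p = g p
  by move=> Up; apply: filterS (open_nbhs_nbhs (conj oU Up)) => q; exact: fg.
all: have g0 p : U p -> {for p, continuous g} /\ forall j, derivable g p (v j)
  by move=> Up; have [cf df] := (smooth_upto0 fk).1 p Up; split=> [|j];
    [rewrite /prop_for /continuous_at -(fg p Up); apply: cvg_trans cf;
     apply: near_eq_cvg; exact: nearfg
    |exact: near_eq_derivable (nearfg p Up) (df j)].
all: split=> //.
move=> j; apply: IHk (fk.2 j) => p Up; exact: near_eq_derive (nearfg p Up).
Qed.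

Lemma smooth_upto_cst k U (c : R) : smooth_upto k U (fun=> c).
Proof.
elim: k c => [|k IHk] c; split=> //.
- by move=> p _; split=> [|j]; [exact: cvg_cst|exact: derivable_cst].
- by move=> p _; split=> [|j]; [exact: cvg_cst|exact: derivable_cst].
move=> j; rewrite (_ : 'D_(v j) _ = fun=> 0) //.
by apply/funext => p; exact: derive_cst.
Qed.

Lemma smooth_uptoD k U f g : open U -> smooth_upto k U f -> smooth_upto k U g ->
  smooth_upto k U (fun p => f p + g p).
Proof.
move=> oU; elim: k f g => [|k IHk] f g fk gk.
all: have fg0 := ((smooth_upto0 fk).1, (smooth_upto0 gk).1).
all: split=> //.
1,2: by move=> p Up; have [[cf df] [cg dg]] := (fg0.1 p Up, fg0.2 p Up);
  split=> [|j]; [exact: cvgD|exact: derivableD].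
move=> j; have := IHk _ _ (fk.2 j) (gk.2 j); apply: smooth_upto_ext => // p Up.
by rewrite [RHS]deriveD//; [apply: (fg0.1 p Up).2|apply: (fg0.2 p Up).2].
Qed.

(** Leibniz rule: each term of the derivative pairs a differentiated factor with an undifferentiated
    one, and the latter is lowered to the same order by [smooth_uptoS]. *)
Lemma smooth_uptoM k U f g : open U -> smooth_upto k U f -> smooth_upto k U g ->
  smooth_upto k U (fun p => f p * g p).
Proof.
move=> oU; elim: k f g => [|k IHk] f g fk gk.
all: have fg0 := ((smooth_upto0 fk).1, (smooth_upto0 gk).1).
all: split=> //.
1,2: by move=> p Up; have [[cf df] [cg dg]] := (fg0.1 p Up, fg0.2 p Up);
  split=> [|j]; [exact: cvgM|exact: derivableM].
move=> j.
have := smooth_uptoD oU (IHk _ _ (smooth_uptoS fk) (gk.2 j))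
                     (IHk _ _ (smooth_uptoS gk) (fk.2 j)).
apply: smooth_upto_ext => // p Up.
by rewrite [RHS]deriveM//; [apply: (fg0.1 p Up).2|apply: (fg0.2 p Up).2].
Qed.

End SmoothUpto.

(** * Smoothness and primitives in one variable *)

Section OneVariable.
Context {R : realType}.
Implicit Types (I : set R) (f F : R -> R).

Notation smooth1 := (smooth_upto (fun _ : unit => 1 : R)).

Lemma derivable_continuous_at f (t : R) :
  derivable f t 1 -> {for t, continuous f}.
Proof. by move=> /derivable1_diffP/differentiable_continuous. Qed.

(** In one variable derivability implies continuity, so the continuity clause of [smooth_upto] comes
    for free. *)
Lemma smooth_on1P I f : smooth_on1 I f <-> forall k, smooth1 k I f.
Proof.
have D1E (g : R -> R) : 'D_1 g = g^`() by apply/funext => t; rewrite derive1E.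
split=> [fI k|fk k t It].
  have f0 g : smooth_on1 I g -> forall s, I s ->
      {for s, continuous g} /\ (unit -> derivable g s 1).
    move=> gI s Is; have dg := gI 0%N s Is.
    by split=> //; exact: derivable_continuous_at.
  elim: k f fI => [|k IHk] f fI; split=> //; [exact: f0|exact: f0|].
  move=> _; rewrite D1E; apply: IHk => m t It.
  by have := fI m.+1 t It; rewrite derive1Sn.
elim: k f fk => [|k IHk] f fk; first by have [_ /(_ tt)] := (fk 0%N).1 t It.
rewrite derive1Sn; apply: IHk => m.
by have := (fk m.+1).2 tt; rewrite D1E.
Qed.

Lemma smooth_upto_primitive k I f F : open I ->
  (forall t, I t -> is_derive t 1 F (f t)) -> smooth1 k I f -> smooth1 k.+1 I F.
Proof.
move=> oI dF fk; split=> [t It|_].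
  by have [dFt _] := dF t It; split=> //; exact: derivable_continuous_at.
by apply: smooth_upto_ext fk => // t It; have [_ ->] := dF t It.
Qed.

Lemma smooth_upto_id k I : open I -> smooth1 k I id.
Proof.
move=> oI; apply: smooth_uptoS.
apply: (smooth_upto_primitive (f := fun=> 1)) => //.
exact: smooth_upto_cst.
Qed.

(** The fundamental theorem of calculus is applied to the integral [F] from a point [l] of [I] below
    both [a] and [t]. Near [t] the oriented integral is [F - F a], whichever of [a] and [t] is
    larger. *)
Lemma is_derive_oriented_integral I f (a t : R) : open I -> is_interval I ->
  (forall s, I s -> {for s, continuous f}) -> I a -> I t ->
  is_derive t 1 (oriented_integral f a) (f t).
Proof.
move=> oI itvI cf Ia It.
have above x : I x -> exists2 u, I u & x < u.
  move=> Ix; have /nbhs_ballP[e/= e0 xeI] := open_nbhs_nbhs (conj oI Ix).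
  exists (x + e / 2); last by rewrite ltrDl divr_gt0.
  by apply: xeI; rewrite -ball_normE/= opprD addNKr normrN gtr0_norm; lra.
have below x : I x -> exists2 l, I l & l < x.
  move=> Ix; have /nbhs_ballP[e/= e0 xeI] := open_nbhs_nbhs (conj oI Ix).
  exists (x - e / 2); last by rewrite ltrBlDr ltrDl divr_gt0.
  by apply: xeI; rewrite -ball_normE/= subKr gtr0_norm; lra.
have [l Il [la lt]] : exists2 l, I l & l < a /\ l < t.
  have [l Il] : exists2 l, I l & l < Num.min a t.
    by apply: below; case: (leP a t).
  by rewrite lt_min => /andP[? ?]; exists l.
have [u Iu [au tu]] : exists2 u, I u & a < u /\ t < u.
  have [u Iu] : exists2 u, I u & Num.max a t < u.
    by apply: above; case: (leP a t).
  by rewrite gt_max => /andP[? ?]; exists u.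
have cluf x : l <= x <= u -> {for x, continuous f}.
  by move=> xlu; apply: cf; exact: itvI xlu.
have int_lx x : x <= u ->
    lebesgue_measure.-integrable `[l, x] (EFin \o f).
  move=> xu; apply: continuous_compact_integrable; first exact: segment_compact.
  apply: continuous_in_subspaceT => z; rewrite inE/= in_itv/= => /andP[lz zx].
  by apply: cluf; rewrite lz (le_trans zx).
pose F x := \int[lebesgue_measure]_(s in `[l, x]) f s.
have FB x y : l <= x -> x <= y -> y <= u ->
    F y - F x = \int[lebesgue_measure]_(s in `[x, y]) f s.
  move=> lx xy yu; rewrite /F Rintegral_itvB ?bnd_simp//; last exact: int_lx.
  apply: Rintegral_itv_obnd_cbnd; apply: integrableS (int_lx y yu) => //.
  by apply: subset_itvr; rewrite bnd_simp.
have orE x : l < x < u -> F x - F a = oriented_integral f a x.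
  move=> /andP[lx xu]; rewrite /oriented_integral; case: leP => [ax|xa].
    by rewrite FB// ltW.
  by rewrite -FB ?ltW// opprB.
have [dF dFt] : derivable F t 1 /\ F^`() t = f t.
  apply: (@continuous_FTC1_closed _ f l t u) => //; last exact: cf.
  exact: int_lx.
have dF' : is_derive t 1 (F - cst (F a)) (f t).
  rewrite -[f t]subr0 -dFt derive1E.
  by apply: is_deriveB; exact: derivableP.
clearbody F; apply: near_eq_is_derive dF'; near=> x.
rewrite -orE//; apply/andP; split.
  by near: x; exact: lt_nbhsr.
by near: x; exact: lt_nbhsl.
Unshelve. all: by end_near. Qed.

End OneVariable.

(** * Smoothness on coordinate space *)

Section SmoothCoordinates.
Context {R : realType} {n : nat}.
Implicit Types (U : set 'rV[R]_n) (I : set R).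

Notation smooth1 := (smooth_upto (fun _ : unit => 1 : R)).
Notation smoothn := (smooth_upto (fun i : 'I_n => delta_mx 0 i : 'rV[R]_n)).

Lemma smooth_upto_smooth_on U (f : 'rV[R]_n -> R) :
  (forall k, smoothn k U f) -> smooth_on U f.
Proof.
(* [iter_partial] differentiates first along the last index of the list, hence the induction from
   the right. *)
move=> fk s; elim/last_ind: s f fk => [|s i IHs] f fk; first exact: (fk 0%N).1.
by rewrite /iter_partial foldr_rcons; apply: IHs => k; exact: (fk k.+1).2.
Qed.

(** A partial derivative of a function of one coordinate is 0 or again such a function, built from
    [derive1 E], so the induction on [k] closes. *)
Lemma smooth_upto_coord k U I (j : 'I_n) (E : R -> R) :
  (forall p, U p -> I (p 0 j)) -> smooth1 k I E ->
  smoothn k U (fun q => E (q 0 j)).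
Proof.
move=> UI; elim: k E => [|k IHk] E Ek.
all: have E0 := (smooth_upto0 Ek).1.
all: split=> //.
1,2: move=> p Up; have [cE /(_ tt) dE] := E0 _ (UI p Up); split=> [|i];
  [apply: (@continuous_comp _ _ _ (fun q : 'rV[R]_n => q 0 j)) => //;
   exact: coord_continuous
  |by have [] := is_derive_coord i dE].
move=> i; rewrite (_ : 'D_(delta_mx 0 i) _ =
    if i == j then fun q => derive1 E (q 0 j) else fun=> 0).
  case: eqP => _; last exact: smooth_upto_cst.
  apply: IHk; have := Ek.2 tt.
  by rewrite (_ : 'D_1 E = derive1 E)//; apply/funext => t; rewrite derive1E.
apply/funext => q; rewrite -/(partial i _ q) partial_coord.
by case: eqP; rewrite ?mul1r ?mul0r.
Qed.

End SmoothCoordinates.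

(** * Curvature and Hessian of the Walker metric *)

Section WalkerCurvature.
Context {R : realType}.
Implicit Types (b : R -> R) (p : 'rV[R]_4) (i j k l : 'I_4).

Lemma ord4P (P : 'I_4 -> Prop) : P ix -> P iy -> P iz -> P it -> forall i, P i.
Proof.
move=> Px Py Pz Pt [[|[|[|[|//]]]] i4].
- by rewrite (_ : Ordinal _ = ix) //; exact: val_inj.
- by rewrite (_ : Ordinal _ = iy) //; exact: val_inj.
- by rewrite (_ : Ordinal _ = iz) //; exact: val_inj.
- by rewrite (_ : Ordinal _ = it) //; exact: val_inj.
Qed.

Lemma sum_ord4 (F : 'I_4 -> R) : \sum_i F i = F ix + F iy + F iz + F it.
Proof.
rewrite !big_ord_recr /= big_ord0 add0r.
by do !congr (_ + _); congr F; exact: val_inj.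
Qed.

Definition walker_inverse b p : 'M[R]_4 :=
  delta_mx ix iz + delta_mx iz ix + delta_mx iy it + delta_mx it iy
  - b (p 0 it) *: delta_mx iy iy.

(** Checking a product entry by entry and using uniqueness of inverses avoids computing a
    determinant and an adjugate. *)
Lemma invmx_walker b p : walker_metric b p \in unitmx /\
  invmx (walker_metric b p) = walker_inverse b p.
Proof.
have gK : walker_metric b p *m walker_inverse b p = 1%:M.
  apply/matrixP => i j; rewrite !mxE sum_ord4 !mxE.
  by elim/ord4P: i; elim/ord4P: j => /=; ring.
have [gU _] := mulmx1_unit gK; split=> //.
by apply: (can_inj (mulKmx gU)); rewrite gK mulmxV.
Qed.

Lemma partial_walker b i j l p :
  partial i (fun q => walker_metric b q j l) p =
  [&& i == it, j == it & l == it]%:R * derive1 b (p 0 it).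
Proof.
(* Every entry of the metric is a function of the coordinate t alone, so [partial_coord] applies. *)
pose F s := (delta_mx ix iz + delta_mx iz ix + delta_mx iy it + delta_mx it iy
  + s *: delta_mx it it : 'M[R]_4) j l.
rewrite (_ : (fun q => _) = fun q : 'rV[R]_4 => (F \o b) (q 0 it)) //.
rewrite partial_coord.
case: (i == it); rewrite ?mul0r //= mul1r.
have [/andP[/eqP jt /eqP lt]|jl] := boolP ((j == it) && (l == it)).
  rewrite mul1r (_ : F \o b = b) //; apply/funext => s.
  by rewrite /F /= jt lt !mxE /= mulr1 !add0r.
rewrite mul0r (_ : F \o b = cst (F 0)) ?derive1_cst //; apply/funext => s.
by rewrite /F /= !mxE (negbTE jl) !mulr0.
Qed.

Lemma christoffel_walker b k i j p :
  christoffel (walker_metric b) k i j p =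
  [&& k == iy, i == it & j == it]%:R * (derive1 b (p 0 it) / 2).
Proof.
rewrite /christoffel (invmx_walker b p).2 sum_ord4 !partial_walker !mxE.
by elim/ord4P: k; elim/ord4P: i; elim/ord4P: j => /=; field.
Qed.

(** The derivative terms are nonzero only when [i], [j] and [k] are all t, where they cancel. In
    each quadratic term [m] is a lower index of one symbol, which forces t, and the upper index of
    the other, which forces y. *)
Lemma riemann_walker b l k i j p : riemann (walker_metric b) l k i j p = 0.
Proof.
have dG i' k' j' : partial i' (christoffel (walker_metric b) l j' k') p =
    [&& i' == it, l == iy, j' == it & k' == it]%:R *
    derive1 (fun s => derive1 b s / 2) (p 0 it).
  pose F s := [&& l == iy, j' == it & k' == it]%:R * (derive1 b s / 2).
  have -> : christoffel (walker_metric b) l j' k' = fun q => F (q 0 it).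
    by apply/funext => q; rewrite christoffel_walker.
  rewrite partial_coord; case: (i' == it); rewrite ?mul0r //= mul1r /F.
  case: [&& _, _ & _].
    by rewrite mul1r; congr (derive1 _ _); apply/funext => s; rewrite mul1r.
  rewrite mul0r (_ : (fun s => _) = cst 0) ?derive1_cst //.
  by apply/funext => s; rewrite mul0r.
rewrite /riemann !dG big1 ?addr0 => [|m _].
  by case: (i == it); case: (j == it); case: (l == iy); rewrite /= ?subrr.
rewrite !christoffel_walker.
by elim/ord4P: m => /=; rewrite ?andbF ?mul0r ?mulr0 ?subrr.
Qed.

Lemma scalar_curvature_walker b p : scalar_curvature (walker_metric b) p = 0.
Proof.
rewrite /scalar_curvature (_ : ricci _ p = 0) ?mulmx0 ?mxtrace0 //.
apply/matrixP => j k; rewrite !mxE big1 // => i _; exact: riemann_walker.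
Qed.

Lemma hessian_walker b (f : 'rV[R]_4 -> R) p i j :
  hessian (walker_metric b) f p i j = partial i (partial j f) p
   - ((i == it) && (j == it))%:R * (derive1 b (p 0 it) / 2) * partial iy f p.
Proof.
by rewrite mxE sum_ord4 !christoffel_walker /= !mul0r !add0r !addr0.
Qed.

Lemma laplacian_scalar_hessian b (f : 'rV[R]_4 -> R) p (c : R) :
  hessian (walker_metric b) f p = c *: walker_metric b p ->
  laplacian (walker_metric b) f p = 4 * c.
Proof.
move=> fp; have [gU _] := invmx_walker b p.
by rewrite /laplacian fp -scalemxAr mulVmx// mxtraceZ mxtrace1 mulrC.
Qed.

End WalkerCurvature.

(** * Differentiation rules for explicit expressions *)

Section DeriveRules.
Context {R : realType} {V : normedModType R}.
Implicit Types (f g : V -> R) (p v : V) (df dg c : R).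

(** This rule and the next ones are phrased with pointwise operations, so that the derivative of an
    explicit formula is assembled by nesting them as terms. *)
Lemma is_derive_addf f g p v df dg : is_derive p v f df -> is_derive p v g dg ->
  is_derive p v (fun q => f q + g q) (df + dg).
Proof. by move=> ? ?; exact: is_deriveD. Qed.

Lemma is_derive_subf f g p v df dg : is_derive p v f df -> is_derive p v g dg ->
  is_derive p v (fun q => f q - g q) (df - dg).
Proof. by move=> ? ?; exact: is_deriveB. Qed.

Lemma is_derive_mulf f g p v df dg : is_derive p v f df -> is_derive p v g dg ->
  is_derive p v (fun q => f q * g q) (f p * dg + g p * df).
Proof. by move=> ? ?; exact: is_deriveM. Qed.

Lemma is_derive_scalef c f p v df : is_derive p v f df ->
  is_derive p v (fun q => c * f q) (c * df).
Proof. by move=> ?; exact: is_deriveZ. Qed.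

Lemma is_derive_addcf f c p v df : is_derive p v f df ->
  is_derive p v (fun q => f q + c) df.
Proof. by move=> fdf; rewrite -[df]addr0; exact: is_derive_addf. Qed.

Lemma is_derive_open (U : set V) f g p v df : open U -> U p ->
  (forall q, U q -> f q = g q) -> is_derive p v f df -> is_derive p v g df.
Proof.
move=> oU Up fg; apply: near_eq_is_derive.
by apply: filterS (open_nbhs_nbhs (conj oU Up)) => q; exact: fg.
Qed.

End DeriveRules.

(** * The normal form of a potential, and the range of t on [U] *)

Section NormalForm.
Context {R : realType}.
Implicit Types (U : set 'rV[R]_4) (E : R -> R).

Lemma is_derive_coord_id n i j (p : 'rV[R]_n) :
  is_derive p (delta_mx 0 i) (fun q => q 0 j) (i == j)%:R.
Proof.
have := is_derive_coord i (@derivable_id _ _ (p 0 j) 1).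
by rewrite derive1_id mulr1.
Qed.

Lemma is_derive_coord_scale n i j (c : R) (p : 'rV[R]_n) :
  is_derive p (delta_mx 0 i) (fun q => c * q 0 j) (c * (i == j)%:R).
Proof. exact/is_derive_scalef/is_derive_coord_id. Qed.

Definition normal_form (c0 c1 c2 c3 : R) E (q : 'rV[R]_4) : R :=
  q 0 ix * (c0 * q 0 iz + c2) + q 0 iy * (c0 * q 0 it + c1) + c3 * q 0 iz
  + E (q 0 it).

(** Listing the four partial derivatives in the order x, y, z, t allows a single statement for a
    variable index [i]. *)
Lemma is_derive_normal_form c0 c1 c2 c3 E (p : 'rV[R]_4) i :
  derivable E (p 0 it) 1 ->
  is_derive p (delta_mx 0 i) (normal_form c0 c1 c2 c3 E)
    (nth 0 [:: c0 * p 0 iz + c2; c0 * p 0 it + c1; c0 * p 0 ix + c3;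
               c0 * p 0 iy + derive1 E (p 0 it)] i).
Proof.
move=> /(is_derive_coord i) dE.
have daff c c' j := is_derive_addcf c' (is_derive_coord_scale i j c p).
apply: is_derive_eq (is_derive_addf (is_derive_addf (is_derive_addf
    (is_derive_mulf (is_derive_coord_id _ _ _) (daff _ _ _))
    (is_derive_mulf (is_derive_coord_id _ _ _) (daff _ _ _)))
  (is_derive_coord_scale _ _ _ _)) dE) _.
by rewrite /GRing.scale /=; elim/ord4P: i {dE daff} => /=; ring.
Qed.

(** A value [s] close to the t-coordinate of [p] is attained by shifting [p] along t only, which
    stays in the box around [p]. *)
Lemma t_range_open U : open U -> open (t_range U).
Proof.
move=> oU; rewrite openE => _ [p Up <-].
have /nbhs_ballP[e/= e0 peU] := open_nbhs_nbhs (conj oU Up).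
apply/nbhs_ballP; exists e => //= s ps.
exists (p + (s - p 0 it) *: delta_mx 0 it); last first.
  by rewrite !mxE !eqxx mulr1 addrC subrK.
apply: peU; split=> // i j; rewrite !mxE (ord1 i) eqxx /=.
have [->|_] := eqVneq j it; first by rewrite mulr1 addrC subrK.
by rewrite mulr0 addr0; exact: ballxx.
Qed.

Lemma t_range_interval U : connected U -> is_interval (t_range U).
Proof.
move=> cU; apply/connected_intervalP/connected_continuous_connected => //.
by apply: continuous_subspaceT => p; exact: coord_continuous.
Qed.

End NormalForm.

(** * From the soliton equation to the normal form *)

Section Potential.
Context {R : realType} (U : set 'rV[R]_4) (b : R -> R) (t0 : R).
Hypotheses (oU : open U) (cU : connected U).
Hypotheses (b_smooth : smooth_on1 (t_range U) b) (It0 : t_range U t0).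

Let I := t_range U.
Let oI : open I := t_range_open oU.
Let UI p : U p -> I (p 0 it). Proof. by exists p. Qed.

Notation smooth1 := (smooth_upto (fun _ : unit => 1 : R)).
Notation smoothn := (smooth_upto (fun i : 'I_4 => delta_mx 0 i : 'rV[R]_4)).

(** The relation of [potential_form], solved for the derivative of [E], says that it equals this
    function plus [k / 2]. *)
Definition soliton_primitive (c0 c1 t : R) : R :=
  2^-1 * (b t * (c0 * t + c1) + c0 * oriented_integral b t0 t).

Let is_derive_b t : I t -> is_derive t 1 b (derive1 b t).
Proof.
move=> It; rewrite derive1E; apply: derivableP.
exact: (@b_smooth 0%N t It).
Qed.

Let is_derive_int f : (forall t, I t -> {for t, continuous f}) ->
  forall t, I t -> is_derive t 1 (oriented_integral f t0) (f t).
Proof.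
move=> cf t It; apply: (is_derive_oriented_integral (I := I)) => //.
exact: t_range_interval.
Qed.

Let is_derive_intb t : I t -> is_derive t 1 (oriented_integral b t0) (b t).
Proof.
apply: is_derive_int => s Is; apply: derivable_continuous_at.
by have [] := is_derive_b Is.
Qed.

(** This is the value of E'' dictated by the tt component of Hess f = c0 g when f_y = c0 t + c1.
    Half of the term [c0 * b t] comes from the product rule, half from the integral. *)
Lemma is_derive_soliton_primitive c0 c1 t : I t ->
  is_derive t 1 (soliton_primitive c0 c1)
    (derive1 b t / 2 * (c0 * t + c1) + c0 * b t).
Proof.
move=> It; apply: is_derive_eq (is_derive_scalef _ (is_derive_addf
  (is_derive_mulf (is_derive_b It)
    (is_derive_addcf _ (is_derive_scalef _ (is_derive_id _ _))))
  (is_derive_scalef _ (is_derive_intb It)))) _.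
by rewrite /GRing.scale /=; field.
Qed.

Lemma smooth_soliton_primitive k c0 c1 : smooth1 k I (soliton_primitive c0 c1).
Proof.
have bk m : smooth1 m I b := (smooth_on1P _ _).1 b_smooth m.
apply: smooth_uptoM => //; first exact: smooth_upto_cst.
apply: smooth_uptoD => //.
  apply: smooth_uptoM => //.
  apply: smooth_uptoD => //; last exact: smooth_upto_cst.
  by apply: smooth_uptoM => //; [exact: smooth_upto_cst|exact: smooth_upto_id].
apply: smooth_uptoM => //; first exact: smooth_upto_cst.
by apply: smooth_uptoS; exact: smooth_upto_primitive is_derive_intb _.
Qed.

Lemma yamabe_potential_form f :
  gradient_yamabe_potential U (walker_metric b) f ->
  exists (c0 c1 c2 c3 k : R) (E : R -> R),
    potential_form U b t0 c0 c1 c2 c3 k E f.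
Proof.
move=> [f_smooth [lambda f_hess]]; have [p0 Up0 _] := It0.
pose c0 := - lambda.
have df p i : U p -> is_derive p (delta_mx 0 i) f (partial i f p).
  by move=> Up; have [_ d] := f_smooth [::] _ Up; exact: derivableP.
have ddf p i j : U p -> is_derive p (delta_mx 0 i) (partial j f)
    (c0 * walker_metric b p i j + ((i == it) && (j == it))%:R *
       (derive1 b (p 0 it) / 2) * partial iy f p).
  move=> Up; have [_ /(_ i)/derivableP d] := f_smooth [:: j] _ Up.
  apply: is_derive_eq d _; have := f_hess p Up; move/matrixP/(_ i j).
  rewrite hessian_walker scalar_curvature_walker sub0r -/c0 [in RHS]mxE.
  by move=> <-; rewrite subrK.
(* Each use of this claim produces one integration constant, namely the difference at [p0]. *)
have eq_upto_cst (h Q : 'rV[R]_4 -> R) :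
    (forall p, U p -> forall i,
      is_derive p (delta_mx 0 i) (fun q => h q - Q q) 0) ->
    exists c, forall p, U p -> h p = Q p + c.
  move=> dh; exists (h p0 - Q p0) => p Up.
  by have <- := zero_gradient_connected oU cU dh Up0 Up; rewrite addrC subrK.
(* The x row of the metric has its only nonzero entry in column z, so f_x has the gradient of c0 z.
   The rows of y and z likewise single out t and x. *)
have [c2 fx] : exists c2, forall p, U p -> partial ix f p = c0 * p 0 iz + c2.
  apply: eq_upto_cst => q Uq i.
  apply: is_derive_eq
    (is_derive_subf (ddf _ _ _ Uq) (is_derive_coord_scale _ _ _ _)) _.
  by rewrite !mxE; elim/ord4P: i => /=; ring.
have [c1 fy] : exists c1, forall p, U p -> partial iy f p = c0 * p 0 it + c1.
  apply: eq_upto_cst => q Uq i.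
  apply: is_derive_eq
    (is_derive_subf (ddf _ _ _ Uq) (is_derive_coord_scale _ _ _ _)) _.
  by rewrite !mxE; elim/ord4P: i => /=; ring.
have [c3 fz] : exists c3, forall p, U p -> partial iz f p = c0 * p 0 ix + c3.
  apply: eq_upto_cst => q Uq i.
  apply: is_derive_eq
    (is_derive_subf (ddf _ _ _ Uq) (is_derive_coord_scale _ _ _ _)) _.
  by rewrite !mxE; elim/ord4P: i => /=; ring.
pose G := soliton_primitive c0 c1.
have dG p i : U p -> is_derive p (delta_mx 0 i) (fun q => G (q 0 it))
    ((i == it)%:R *
       (derive1 b (p 0 it) / 2 * (c0 * p 0 it + c1) + c0 * b (p 0 it))).
  move=> Up; have [dG <-] := is_derive_soliton_primitive c0 c1 (UI Up).
  by rewrite -derive1E; exact: is_derive_coord.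
(* The Christoffel term of f_tt contains f_y, which is known by now; the result is exactly the
   derivative of [G] plus no further dependence on f. *)
have [c4 ft] : exists c4, forall p, U p ->
    partial it f p = c0 * p 0 iy + G (p 0 it) + c4.
  apply: eq_upto_cst => q Uq i; apply: is_derive_eq
    (is_derive_subf (ddf _ _ _ Uq)
      (is_derive_addf (is_derive_coord_scale _ _ _ _) (dG _ _ Uq))) _.
  by rewrite !mxE fy//; elim/ord4P: i => /=; ring.
pose g t := G t + c4.
have g_smooth m : smooth1 m I g.
  apply: smooth_uptoD => //; first exact: smooth_soliton_primitive.
  exact: smooth_upto_cst.
have dE0 : forall t, I t -> is_derive t 1 (oriented_integral g t0) (g t).
  by apply: is_derive_int => t It; have [] := (g_smooth 0%N).1 t It.
pose Q := normal_form c0 c1 c2 c3 (oriented_integral g t0).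
have [c5 fE] : exists c5, forall p, U p -> f p = Q p + c5.
  apply: eq_upto_cst => q Uq i; have [dEq Eq] := dE0 _ (UI Uq).
  apply: is_derive_eq
    (is_derive_subf (df _ _ Uq) (is_derive_normal_form _ _ _ _ i dEq)) _.
  rewrite derive1E Eq.
  by elim/ord4P: i => /=; rewrite ?fx ?fy ?fz ?ft// /g; ring.
(* Here [E] has derivative [g], that is [G + c4]. The relation involves twice this derivative, hence
   [k = 2 * c4], while [c5] is absorbed into [E]. *)
exists c0, c1, c2, c3, (2 * c4), (fun t => oriented_integral g t0 t + c5).
have dE t : I t -> is_derive t 1 (fun t => oriented_integral g t0 t + c5) (g t).
  by move=> It; exact/is_derive_addcf/dE0.
split.
- apply/smooth_on1P => m; apply: smooth_uptoS.
  exact: smooth_upto_primitive dE _.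
- by move=> p Up; rewrite fE// /Q /normal_form addrA.
- move=> t It; have [_] := dE t It; rewrite -derive1E => ->.
  by rewrite /g /G /soliton_primitive; field.
Qed.

(** * From the normal form back to the soliton equation *)

Section Converse.
Variables (f : 'rV[R]_4 -> R) (c0 c1 c2 c3 k : R) (E : R -> R).
Hypothesis fE : potential_form U b t0 c0 c1 c2 c3 k E f.

Lemma potential_form_hessian p : U p ->
  hessian (walker_metric b) f p = c0 *: walker_metric b p.
Proof.
have [E_smooth fQ EG] := fE.
pose df (j : 'I_4) (q : 'rV[R]_4) : R := nth 0
  [:: c0 * q 0 iz + c2; c0 * q 0 it + c1; c0 * q 0 ix + c3;
      c0 * q 0 iy + derive1 E (q 0 it)] j.
have fdf j q : U q -> partial j f q = df j q.
  move=> Uq; apply: derive_val; apply: (is_derive_open oU Uq).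
    by move=> r Ur; rewrite fQ.
  exact/is_derive_normal_form/(@E_smooth 0%N _ (UI Uq)).
(* The relation identifies the derivative of [E] with [G] on the open set [I], which yields the
   second derivative explicitly in terms of [b]. *)
have ddE t : I t -> is_derive t 1 (derive1 E)
    (derive1 b t / 2 * (c0 * t + c1) + c0 * b t).
  pose G s := soliton_primitive c0 c1 s + k / 2.
  move=> It; apply: (is_derive_open (f := G) oI It) => [s Is|].
    by have := EG s Is; rewrite /G /soliton_primitive; lra.
  exact/is_derive_addcf/is_derive_soliton_primitive.
move=> Up; apply/matrixP => i j; rewrite hessian_walker fdf//.
(* The formula for the first derivatives holds only on [U]; openness makes it valid near [p], so it
   may be differentiated again. *)
have -> : partial i (partial j f) p = partial i (df j) p.
  apply: near_eq_derive; apply: filterS (open_nbhs_nbhs (conj oU Up)) => q.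
  exact: fdf.
have [dE ddEt] := ddE _ (UI Up); rewrite -derive1E in ddEt.
have ddf c d l : partial i (fun q => c * q 0 l + d) p = c * (i == l)%:R.
  by have [] := is_derive_addcf d (is_derive_coord_scale i l c p).
have ddft : partial i (fun q => c0 * q 0 iy + derive1 E (q 0 it)) p =
    c0 * (i == iy)%:R + (i == it)%:R *
      (derive1 b (p 0 it) / 2 * (c0 * p 0 it + c1) + c0 * b (p 0 it)).
  rewrite -ddEt.
  by have [] := is_derive_addf (is_derive_coord_scale i iy c0 p)
                               (is_derive_coord i dE).
have -> : partial i (df j) p = nth 0
    [:: c0 * (i == iz)%:R; c0 * (i == it)%:R; c0 * (i == ix)%:R;
        c0 * (i == iy)%:R + (i == it)%:R *
          (derive1 b (p 0 it) / 2 * (c0 * p 0 it + c1) + c0 * b (p 0 it))] j.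
  by elim/ord4P: j; [exact: ddf|exact: ddf|exact: ddf|exact: ddft].
by rewrite !mxE; elim/ord4P: i {ddf ddft}; elim/ord4P: j; rewrite /df /=; field.
Qed.

(** On [U] the function is a polynomial in the coordinates plus [E] of the coordinate t, so the
    closure properties apply at every order. *)
Lemma potential_form_smooth : smooth_on U f.
Proof.
have [E_smooth fQ _] := fE.
apply: smooth_upto_smooth_on => m.
have coordk (j : 'I_4) : smoothn m U (fun q => q 0 j).
  apply: (smooth_upto_coord (I := setT) (E := id)) => //.
  exact/smooth_upto_id/openT.
have link (c : R) (j : 'I_4) : smoothn m U (fun q => c * q 0 j).
  by apply: smooth_uptoM => //; exact: smooth_upto_cst.
apply: (smooth_upto_ext (f := normal_form c0 c1 c2 c3 E)) => // [p Up|].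
  by rewrite fQ.
apply: smooth_uptoD => //; last first.
  apply: (smooth_upto_coord (I := I)) => //.
  exact: ((smooth_on1P _ _).1 E_smooth m).
apply: smooth_uptoD => //; apply: smooth_uptoD => //; apply: smooth_uptoM => //.
all: by apply: smooth_uptoD => //; exact: smooth_upto_cst.
Qed.

End Converse.
End Potential.

Theorem theorem5 (R : realType) (U : set 'rV[R]_4) (b : R -> R) (t0 : R)
    (U_open : open U) (U_connected : connected U)
    (b_smooth : smooth_on1 (t_range U) b) (t0_in : t_range U t0) :
  (forall f : 'rV[R]_4 -> R,
     gradient_yamabe_potential U (walker_metric b) f <->
     exists (c0 c1 c2 c3 k : R) (E : R -> R),
       potential_form U b t0 c0 c1 c2 c3 k E f) /\
  (forall (f : 'rV[R]_4 -> R) (c0 c1 c2 c3 k : R) (E : R -> R),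
     potential_form U b t0 c0 c1 c2 c3 k E f ->
     forall p, U p -> laplacian (walker_metric b) f p = 4 * c0).
Proof.
have hess := potential_form_hessian U_open U_connected b_smooth t0_in.
split=> [f|f c0 c1 c2 c3 k E fE p Up].
  split; first exact: yamabe_potential_form.
  move=> [c0 [c1 [c2 [c3 [k [E fE]]]]]]; split.
    exact: (potential_form_smooth U_open fE).
  (* With zero scalar curvature the factor of the metric is [- lambda], which must be [c0]. *)
  exists (- c0) => p Up; rewrite scalar_curvature_walker sub0r opprK.
  exact: (hess _ _ _ _ _ _ _ fE).
by apply: laplacian_scalar_hessian; exact: (hess _ _ _ _ _ _ _ fE).
Qed.
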